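(* Let $t_0>0$, let $\alpha,\beta,\gamma$ be quotients of odd positive integers, let $r_1,r_2\in C([t_0,\infty),(0,\infty))$ satisfy $\int_{t_0}^{\infty}r_1^{-1/\alpha}(s)\,ds<\infty$ and $\int_{t_0}^{\infty}r_2^{-1/\beta}(s)\,ds<\infty$, let $q\in C([t_0,\infty),[0,\infty))$ not vanish eventually, and let $\sigma\in C^1([t_0,\infty),(0,\infty))$ satisfy $\sigma(t)\ge t$ and $\sigma'(t)\ge 0$ for all $t\ge t_0$. Consider the equation $$\left(r_2(t)\left(\left(r_1(t)(y'(t))^{\alpha}\right)'\right)^{\beta}\right)'+q(t)\,y^{\gamma}(\sigma(t))=0,\quad t\ge t_0.\qquad (E)$$ Let $\pi_2(t)=\int_t^{\infty}r_2^{-1/\beta}(s)\,ds$ and $\pi(t)=\int_t^{\infty}r_1^{-1/\alpha}(s)\,\pi_2^{1/\alpha}(s)\,ds$. If $$\int_{t_0}^{\infty}r_1^{-\frac1\alpha}(v)\left(\int_{t_0}^{v}r_2^{-\frac1\beta}(u)\left(\int_{t_0}^{u}\pi^{\gamma}(\sigma(s))\,q(s)\,ds\right)^{\frac1\beta}du\right)^{\frac1\alpha}dv=\infty,$$ then $(E)$ has property A.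
   Context: Powers whose exponents are quotients of odd positive integers are taken as real-valued odd functions, also for negative arguments. ''$q$ does not vanish eventually'' means that $q$ is not identically zero on any half-line $[T,\infty)$. A solution of $(E)$ is a nontrivial real-valued function $y\in C([T_y,\infty),\mathbb{R})$, $T_y\ge t_0$, such that $y$, $r_1(y')^{\alpha}$ and $r_2((r_1(y')^{\alpha})')^{\beta}$ are continuous and differentiable on $[T_y,\infty)$ and $y$ satisfies $(E)$ on $[T_y,\infty)$. Only solutions with $\sup\{|y(t)|:T\le t<\infty\}>0$ for every $T\ge T_y$ are considered, and it is assumed that $(E)$ possesses such solutions. A solution is oscillatory if it has arbitrarily large zeros in $[T_y,\infty)$, and nonoscillatory otherwise. Equation $(E)$ has property A if every solution $y$ is either oscillatory or satisfies $\lim_{t\to\infty}y(t)=0$. *)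

(* Defs.v *)
From Stdlib Require Import Reals.
From Coquelicot Require Import Coquelicot.
Open Scope R_scope.

Definition odd_quotient (a : R) : Prop :=
  exists m n : nat, Nat.Odd m /\ Nat.Odd n /\ a = INR m / INR n.

(** Power with an exponent [a] of the form [± m / n], [m] and [n] odd, extended
    to negative arguments as an odd function. Since [sign 0 = 0], also
    [opow 0 a = 0], whereas [Rpower 0 a = 1]. *)
Definition opow (x a : R) : R := sign x * Rpower (Rabs x) a.

Definition ray (T : R) : R -> Prop := fun t => T <= t.

(** Continuity and derivatives on [[T, oo)] are relative to that half-line,
    hence one-sided at [T]; values of the functions before [T] play no role. *)
Definition continuous_on_ray (T : R) (f : R -> R) : Prop :=
  forall t, T <= t -> continue_in f (ray T) t.

Definition derivative_on_ray (T : R) (f df : R -> R) : Prop :=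
  forall t, T <= t -> D_in f df (ray T) t.

Definition pi2 (beta : R) (r2 : R -> R) (t : R) : R :=
  RInt_gen (fun s => opow (r2 s) (- / beta)) (at_point t) (Rbar_locally p_infty).

Definition pi (alpha beta : R) (r1 r2 : R -> R) (t : R) : R :=
  RInt_gen (fun s => opow (r1 s) (- / alpha) * opow (pi2 beta r2 s) (/ alpha))
    (at_point t) (Rbar_locally p_infty).

Section Equation.

Variables (t0 alpha beta gamma : R) (r1 r2 q sigma : R -> R).

(** [dy], [du] and [dw] are the derivatives of [y], of [u = r1 (y')^alpha] and
    of [w = r2 (u')^beta]; they are determined by [y] on [[Ty, oo)]. *)
Definition is_solution (Ty : R) (y : R -> R) : Prop :=
  t0 <= Ty /\
  (exists t, Ty <= t /\ y t <> 0) /\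
  exists dy du dw : R -> R,
    let u := fun t => r1 t * opow (dy t) alpha in
    let w := fun t => r2 t * opow (du t) beta in
    continuous_on_ray Ty y /\ derivative_on_ray Ty y dy /\
    continuous_on_ray Ty u /\ derivative_on_ray Ty u du /\
    continuous_on_ray Ty w /\ derivative_on_ray Ty w dw /\
    forall t, Ty <= t -> dw t + q t * opow (y (sigma t)) gamma = 0.

Definition proper_solution (Ty : R) (y : R -> R) : Prop :=
  is_solution Ty y /\
  forall T, Ty <= T ->
    Rbar_lt 0 (Lub_Rbar (fun v => exists t, T <= t /\ v = Rabs (y t))).

Definition oscillatory (Ty : R) (y : R -> R) : Prop :=
  forall T, exists t, T <= t /\ Ty <= t /\ y t = 0.

Definition property_A : Prop :=
  forall Ty y, proper_solution Ty y ->
    oscillatory Ty y \/ is_lim y p_infty 0.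

End Equation.

(* Main.v *)
Require Import Defs.
From Stdlib Require Import Reals Lra Classical.
From Coquelicot Require Import Coquelicot.
Open Scope R_scope.

(** Let [y] be a nonoscillatory solution; since the equation is odd in [y], it
    may be taken positive from some time on. With [u = r1 (y')^alpha] and
    [w = r2 (u')^beta], the equation makes [w] nonincreasing, so [w], hence
    [u'], is eventually of one sign; then [u] is monotone and eventually of one
    sign, so [y] is eventually monotone. Consequently either [y] tends to 0 or
    [y >= c] eventually, for some [c > 0].

    The second alternative is contradictory. Let [J], [I] and [O] be the
    innermost, middle and outermost integrals in the hypothesis. Since
    [r1^(-1/alpha)] and [r2^(-1/beta)] are integrable, the divergence of [O]
    forces that of [I] and then that of [J] ([weighted_integral_diverges]). As
    [pi] is bounded, [y (sigma t) >= k pi (sigma t)] with [k > 0], so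
    [w' <= - k0 J'] with [k0 = k^gamma], and hence [w <= - k0 J / 2] eventually.
    Solving for [u'] gives [u' <= - k1 I'], hence [u <= - k1 I / 2] eventually;
    solving for [y'] gives [y' <= - k2 O'], hence [y <= - k2 O / 2] eventually
    ([integrate_upper_bound], [solve_power]). So [y] becomes negative
    ([positive_solution_tends_to_0]).

    Increasing and decreasing [y] are treated alike, because the comparison with
    [pi] rests on the boundedness of [pi] alone. *)

(** * Odd powers *)

Lemma odd_quotient_pos a : odd_quotient a -> 0 < a.
Proof.
  intros (m & n & [k Hm] & [l Hn] & ->).
  apply Rdiv_lt_0_compat; apply lt_0_INR; subst.
  all: rewrite Nat.add_1_r; apply Nat.lt_0_succ.
Qed.

Lemma opow_Rpower x a : 0 < x -> opow x a = Rpower x a.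
Proof.
  intros Hx; unfold opow.
  rewrite sign_eq_1, Rabs_pos_eq by lra; ring.
Qed.

Lemma opow_0 a : opow 0 a = 0.
Proof. unfold opow; rewrite sign_0; ring. Qed.

Lemma opow_opp x a : opow (- x) a = - opow x a.
Proof. unfold opow; rewrite sign_opp, Rabs_Ropp; ring. Qed.

Lemma opow_pos x a : 0 < x -> 0 < opow x a.
Proof. intros Hx; rewrite opow_Rpower by easy; apply exp_pos. Qed.

Lemma opow_nonneg x a : 0 <= x -> 0 <= opow x a.
Proof.
  intros [Hx | <-]; [left; now apply opow_pos | rewrite opow_0; lra].
Qed.

Lemma opow_mult x y a : opow (x * y) a = opow x a * opow y a.
Proof.
  destruct (Req_dec x 0) as [-> | Hx].
  { rewrite Rmult_0_l, opow_0; ring. }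
  destruct (Req_dec y 0) as [-> | Hy].
  { rewrite Rmult_0_r, opow_0; ring. }
  unfold opow.
  rewrite sign_mult, Rabs_mult, <- Rpower_mult_distr by now apply Rabs_pos_lt.
  ring.
Qed.

Lemma opow_inv x a : 0 < a -> opow (opow x a) (/ a) = x.
Proof.
  intros Ha.
  assert (Hpos : forall z, 0 < z -> opow (opow z a) (/ a) = z).
  { intros z Hz.
    rewrite opow_Rpower by now apply opow_pos.
    rewrite opow_Rpower, Rpower_mult, Rinv_r by lra.
    now apply Rpower_1. }
  destruct (Rtotal_order x 0) as [Hx | [-> | Hx]].
  - generalize (Hpos (- x)); rewrite !opow_opp; lra.
  - now rewrite !opow_0.
  - now apply Hpos.
Qed.

Lemma opow_le x y a : 0 < a -> x <= y -> opow x a <= opow y a.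
Proof.
  intros Ha Hxy.
  assert (Hpos : forall u v, 0 < u <= v -> opow u a <= opow v a).
  { intros u v Huv; rewrite !opow_Rpower by lra.
    apply Rle_Rpower_l; lra. }
  destruct (Rle_lt_dec y 0) as [Hy | Hy].
  - destruct Hy as [Hy | ->].
    + generalize (Hpos (- y) (- x)); rewrite !opow_opp; lra.
    + generalize (opow_nonneg (- x) a); rewrite opow_opp, opow_0; lra.
  - destruct (Rle_lt_dec x 0) as [Hx | Hx].
    + generalize (opow_nonneg (- x) a) (opow_pos y a Hy).
      rewrite opow_opp; lra.
    + apply Hpos; lra.
Qed.

Lemma opow_le_0_inv x a : opow x a <= 0 -> x <= 0.
Proof.
  intros H; apply Rnot_lt_le; intros Hx.
  generalize (opow_pos x a Hx); lra.
Qed.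

Lemma opow_ge_0_inv x a : 0 <= opow x a -> 0 <= x.
Proof.
  intros H; apply Rnot_lt_le; intros Hx.
  generalize (opow_pos (- x) a ltac:(lra)); rewrite opow_opp; lra.
Qed.

Lemma continuous_opow_pos x a : 0 < x -> continuous (fun z => opow z a) x.
Proof.
  intros Hx.
  apply continuous_ext_loc with (fun z => Rpower z a).
  - exists (mkposreal x Hx); intros z Hz.
    symmetry; apply opow_Rpower.
    unfold ball in Hz; simpl in Hz; unfold AbsRing_ball, abs, minus, plus, opp in Hz.
    simpl in Hz; apply Rabs_def2 in Hz; lra.
  - apply (ex_derive_continuous (fun z => Rpower z a)).
    exists (a * Rpower x (a - 1)).
    apply is_derive_Reals, derivable_pt_lim_power; exact Hx.
Qed.

Lemma continuous_opow x a : 0 < a -> continuous (fun z => opow z a) x.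
Proof.
  intros Ha.
  destruct (Rtotal_order x 0) as [Hx | [-> | Hx]].
  - apply continuous_ext with (fun z : R => - opow (- z) a).
    { intros z; rewrite opow_opp; apply Ropp_involutive. }
    apply (continuous_opp (fun z : R => opow (- z) a)).
    apply (continuous_comp (fun z : R => - z) (fun z => opow z a)).
    + apply (continuous_opp (fun z : R => z)), continuous_id.
    + apply continuous_opow_pos; lra.
  - apply continuity_pt_filterlim.
    intros eps Heps.
    (* [opow] is the increasing inverse of the power of exponent [/ a], which
       dictates the modulus of continuity at 0. *)
    set (d := opow (eps / 2) (/ a)).
    assert (Hd : opow d a = eps / 2).
    { unfold d; rewrite <- (Rinv_inv a) at 2.
      apply opow_inv, Rinv_0_lt_compat, Ha. }
    exists d; split; [apply opow_pos; lra |].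
    intros z [_ Hz]; unfold dist in *; simpl in *; unfold Rdist in *.
    rewrite opow_0, Rminus_0_r.
    rewrite Rminus_0_r in Hz; apply Rabs_def2 in Hz.
    generalize (opow_le z d a Ha ltac:(lra)) (opow_le (- d) z a Ha ltac:(lra)).
    rewrite opow_opp, Hd; intros; apply Rabs_def1; lra.
  - now apply continuous_opow_pos.
Qed.

(** Solves [r d^a <= - c G] for [d], the step that turns a bound on a
    quasi-derivative into one on the derivative that it contains. *)
Lemma solve_power a r d c G :
  0 < a -> 0 < r -> r * opow d a <= - c * G ->
  d <= - opow c (/ a) * (opow r (- / a) * opow G (/ a)).
Proof.
  intros Ha Hr H.
  assert (Ha' : 0 < / a) by now apply Rinv_0_lt_compat.
  apply (opow_le _ _ (/ a) Ha') in H.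
  rewrite !opow_mult, opow_opp, opow_inv in H by easy.
  assert (E : opow r (/ a) * opow r (- / a) = 1).
  { rewrite !opow_Rpower, <- Rpower_plus, Rplus_opp_r by easy.
    now apply Rpower_O. }
  assert (Hp : 0 < opow r (- / a)) by now apply opow_pos.
  apply (Rmult_le_compat_r _ _ _ (Rlt_le _ _ Hp)) in H.
  replace d with (d * (opow r (/ a) * opow r (- / a))) by (rewrite E; ring).
  lra.
Qed.

(** * Continuity and derivatives on a half-line *)

(** Freezing [f] before [T] turns relative continuity on the half-line into
    plain continuity, the form that the integration lemmas require. *)
Definition clamp (T : R) (f : R -> R) : R -> R := fun t => f (Rmax T t).

Definition ray_continuous (T : R) (f : R -> R) : Prop :=
  forall t, continuous (clamp T f) t.

Lemma clamp_eq T f t : T <= t -> clamp T f t = f t.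
Proof. intros H; unfold clamp; now rewrite Rmax_right. Qed.

Lemma Rmax_dist T x t : Rabs (Rmax T x - Rmax T t) <= Rabs (x - t).
Proof.
  unfold Rmax; destruct (Rle_dec T x), (Rle_dec T t);
    unfold Rabs; repeat destruct Rcase_abs; lra.
Qed.

Lemma continuous_Rmax T t : continuous (Rmax T) t.
Proof.
  apply continuity_pt_filterlim; intros eps Heps; exists eps; split; [easy |].
  intros x [_ Hx]; unfold dist in *; simpl in *; unfold Rdist in *.
  generalize (Rmax_dist T x t); lra.
Qed.

Lemma ray_continuous_intro T f : continuous_on_ray T f -> ray_continuous T f.
Proof.
  intros Hf t; apply continuity_pt_filterlim; intros eps Heps.
  destruct (Hf (Rmax T t) (Rmax_l T t) eps Heps) as (d & Hd & Hlim).
  exists d; split; [easy |].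
  intros x [_ Hx]; unfold dist in *; simpl in *; unfold Rdist, clamp in *.
  destruct (Req_dec (Rmax T x) (Rmax T t)) as [-> | Hne].
  - rewrite Rminus_diag, Rabs_R0; lra.
  - apply Hlim; split.
    + split; [apply Rmax_l | now apply not_eq_sym].
    + generalize (Rmax_dist T x t); lra.
Qed.

Lemma ray_continuous_of_derivative T f df :
  derivative_on_ray T f df -> ray_continuous T f.
Proof.
  intros Hf; apply ray_continuous_intro; intros t Ht.
  exact (cont_deriv f df (ray T) t (Hf t Ht)).
Qed.

Lemma ray_continuous_continuous T f t :
  ray_continuous T f -> T < t -> continuous f t.
Proof.
  intros Hf Ht; apply continuous_ext_loc with (clamp T f); [| apply Hf].
  apply (filter_imp (fun x => T < x)); [| now apply open_gt].
  intros x Hx; apply clamp_eq; lra.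
Qed.

Lemma ray_continuous_ext T f g :
  (forall t, T <= t -> f t = g t) -> ray_continuous T f -> ray_continuous T g.
Proof.
  intros E Hf t; apply continuous_ext with (clamp T f); [| apply Hf].
  intros x; apply E, Rmax_l.
Qed.

Lemma ray_continuous_mult T f g :
  ray_continuous T f -> ray_continuous T g -> ray_continuous T (fun t => f t * g t).
Proof.
  intros Hf Hg t; exact (continuous_mult (clamp T f) (clamp T g) t (Hf t) (Hg t)).
Qed.

Lemma ray_continuous_opow T f a :
  0 < a -> ray_continuous T f -> ray_continuous T (fun t => opow (f t) a).
Proof.
  intros Ha Hf t.
  apply (continuous_comp (clamp T f) (fun z => opow z a)); [apply Hf |].
  now apply continuous_opow.
Qed.

Lemma ray_continuous_opow_pos T f a :
  (forall t, T <= t -> 0 < f t) -> ray_continuous T f ->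
  ray_continuous T (fun t => opow (f t) a).
Proof.
  intros Hpos Hf t.
  apply (continuous_comp (clamp T f) (fun z => opow z a)); [apply Hf |].
  apply continuous_opow_pos, Hpos, Rmax_l.
Qed.

Lemma ray_continuous_comp T f s :
  (forall t, T <= t -> T <= s t) -> ray_continuous T f -> ray_continuous T s ->
  ray_continuous T (fun t => f (s t)).
Proof.
  intros Hs Hf Hsc t.
  apply continuous_ext with (fun x => clamp T f (clamp T s x)).
  { intros x; apply (clamp_eq T f (clamp T s x)), Hs, Rmax_l. }
  apply (continuous_comp (clamp T s) (clamp T f)); [apply Hsc | apply Hf].
Qed.

Lemma derivative_on_ray_interior T f df t :
  derivative_on_ray T f df -> T < t -> is_derive f t (df t).
Proof.
  intros Hf Ht; apply is_derive_Reals; intros eps Heps.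
  destruct (Hf t (Rlt_le _ _ Ht) eps Heps) as (d & Hd & Hlim).
  assert (Hm : 0 < Rmin d (t - T)) by (apply Rmin_glb_lt; lra).
  exists (mkposreal _ Hm); intros h Hh Hhd; simpl in Hhd.
  assert (H1 := Rmin_l d (t - T)); assert (H2 := Rmin_r d (t - T)).
  assert (Hx : D_x (ray T) t (t + h) /\ Rabs (t + h - t) < d).
  { replace (t + h - t) with h by ring; split; [| lra].
    apply Rabs_def2 in Hhd; split; [unfold ray |]; lra. }
  specialize (Hlim _ Hx).
  unfold dist in Hlim; simpl in Hlim; unfold Rdist in Hlim.
  now replace (t + h - t) with h in Hlim by ring.
Qed.

Lemma derivative_nonneg_le T f df :
  (forall t, T <= t -> is_derive f t (df t)) -> (forall t, T <= t -> 0 <= df t) ->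
  forall s t, T <= s -> s <= t -> f s <= f t.
Proof.
  intros Hf Hdf s t Hs Hst.
  destruct (MVT_gen f s t df) as (c & Hc & E).
  - intros x Hx; apply Hf; rewrite Rmin_left in Hx; lra.
  - intros x Hx; rewrite Rmin_left in Hx by lra.
    apply continuity_pt_filterlim, (ex_derive_continuous f).
    exists (df x); apply Hf; lra.
  - rewrite Rmin_left in Hc by lra.
    generalize (Rmult_le_pos _ (t - s) (Hdf c ltac:(lra)) ltac:(lra)); lra.
Qed.

Lemma derivative_nonpos_ge T f df :
  (forall t, T <= t -> is_derive f t (df t)) -> (forall t, T <= t -> df t <= 0) ->
  forall s t, T <= s -> s <= t -> f t <= f s.
Proof.
  intros Hf Hdf s t Hs Hst.
  apply Ropp_le_cancel.
  apply (derivative_nonneg_le T (fun x => - f x) (fun x => - df x)); trivial.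
  - intros x Hx; apply (is_derive_opp f), Hf, Hx.
  - intros x Hx; generalize (Hdf x Hx); lra.
Qed.

(** A monotone function crosses 0 at most once. Weak signs in the hypothesis and
    the conclusion let the lemma be applied to [w] and then to [u]. *)
Lemma monotone_eventually_signed T f df :
  (forall t, T <= t -> is_derive f t (df t)) ->
  (forall t, T <= t -> 0 <= df t) \/ (forall t, T <= t -> df t <= 0) ->
  exists T', T <= T' /\
    ((forall t, T' <= t -> 0 <= f t) \/ (forall t, T' <= t -> f t <= 0)).
Proof.
  intros Hf [Hd | Hd].
  - destruct (classic (exists s, T <= s /\ 0 <= f s)) as [(s & Hs & Hfs) | Hno].
    + exists s; split; [easy | left]; intros t Ht.
      generalize (derivative_nonneg_le T f df Hf Hd s t Hs Ht); lra.
    + exists T; split; [lra | right]; intros t Ht.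
      apply Rnot_lt_le; intros H; apply Hno; exists t; lra.
  - destruct (classic (exists s, T <= s /\ f s <= 0)) as [(s & Hs & Hfs) | Hno].
    + exists s; split; [easy | right]; intros t Ht.
      generalize (derivative_nonpos_ge T f df Hf Hd s t Hs Ht); lra.
    + exists T; split; [lra | left]; intros t Ht.
      apply Rnot_lt_le; intros H; apply Hno; exists t; lra.
Qed.

(** * Integrals with a variable upper bound *)

Section Primitive.

Variables (T : R) (f : R -> R).
Hypothesis f_cont : ray_continuous T f.

Lemma ex_RInt_ray a b : T <= a -> T <= b -> ex_RInt f a b.
Proof.
  intros Ha Hb; apply ex_RInt_ext with (clamp T f).
  - intros x Hx; apply clamp_eq.
    generalize (Rmin_glb a b T Ha Hb); lra.
  - apply (ex_RInt_continuous (clamp T f)); intros; apply f_cont.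
Qed.

Lemma is_derive_RInt_ray t : T < t -> is_derive (fun u => RInt f T u) t (f t).
Proof.
  intros Ht; apply is_derive_RInt with T.
  - apply (filter_imp (fun x => T < x)); [| now apply open_gt].
    intros x Hx; apply (RInt_correct f), ex_RInt_ray; lra.
  - now apply (ray_continuous_continuous T).
Qed.

Lemma ray_continuous_RInt : ray_continuous T (fun u => RInt f T u).
Proof.
  intros t.
  apply continuous_ext with (fun x => RInt (clamp T f) T (Rmax T x)).
  { intros x; apply RInt_ext; intros z Hz; apply clamp_eq.
    rewrite Rmin_left in Hz by apply Rmax_l; lra. }
  apply (continuous_comp (Rmax T) (fun x => RInt (clamp T f) T x)).
  - apply continuous_Rmax.
  - apply (ex_derive_continuous (fun x => RInt (clamp T f) T x)).
    eexists; apply is_derive_RInt with T; [| apply f_cont].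
    apply filter_forall; intros x; apply (RInt_correct (clamp T f)).
    apply (ex_RInt_continuous (clamp T f)); intros; apply f_cont.
Qed.

Lemma RInt_ray_Chasles s t :
  T <= s -> T <= t -> RInt f T s + RInt f s t = RInt f T t.
Proof.
  intros Hs Ht; apply (RInt_Chasles f); apply ex_RInt_ray; lra.
Qed.

Hypothesis f_nonneg : forall t, T <= t -> 0 <= f t.

Lemma RInt_ray_mono s t : T <= s -> s <= t -> RInt f T s <= RInt f T t.
Proof.
  intros Hs Hst; rewrite <- (RInt_ray_Chasles s t) by lra.
  assert (0 <= RInt f s t); [| lra].
  apply RInt_ge_0; [easy | apply ex_RInt_ray; lra |].
  intros x Hx; apply f_nonneg; lra.
Qed.

Lemma RInt_ray_nonneg t : T <= t -> 0 <= RInt f T t.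
Proof.
  intros Ht; generalize (RInt_ray_mono T t ltac:(lra) Ht).
  now rewrite RInt_point.
Qed.

Lemma ex_RInt_gen_bounded :
  ex_RInt_gen f (at_point T) (Rbar_locally p_infty) ->
  exists B, forall t, T <= t -> RInt f T t <= B.
Proof.
  intros [l Hl].
  destruct (Hl (ball l 1)) as [P Q HP [N HN] H].
  { now exists (mkposreal 1 Rlt_0_1). }
  exists (l + 1); intros t Ht.
  destruct (H T (Rmax t (N + 1)) HP) as (v & Hv & Hb).
  { apply HN; generalize (Rmax_r t (N + 1)); lra. }
  assert (E : RInt f T (Rmax t (N + 1)) = v) by exact (is_RInt_unique _ _ _ _ Hv).
  change (Rabs (v - l) < 1) in Hb; apply Rabs_def2 in Hb.
  generalize (RInt_ray_mono t (Rmax t (N + 1)) Ht (Rmax_l _ _)); lra.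
Qed.

(** The integral over a tail is the total minus a primitive: this carries
    continuity, sign and bounds over to [pi2] and [pi]. *)
Lemma RInt_gen_tail B :
  (forall t, T <= t -> RInt f T t <= B) ->
  exists K, (forall t, T <= t -> RInt f T t <= K) /\
    forall t, T <= t ->
      RInt_gen f (at_point t) (Rbar_locally p_infty) = K - RInt f T t.
Proof.
  intros HB.
  destruct (completeness (fun v => exists t, T <= t /\ v = RInt f T t))
    as [K [Hub Hlub]].
  - exists B; intros v (t & Ht & ->); now apply HB.
  - exists (RInt f T T), T; split; [lra | easy].
  - assert (HK : forall t, T <= t -> RInt f T t <= K).
    { intros t Ht; apply Hub; now exists t. }
    exists K; split; [exact HK |]; intros t Ht.
    apply is_RInt_gen_unique; intros P [eps HP].
    destruct (classic (exists s, T <= s /\ K - eps < RInt f T s))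
      as [(s & Hs & HsK) | Hno].
    + exists (fun x => x = t) (fun x => Rmax s t < x); [easy | |].
      { now exists (Rmax s t). }
      intros x b -> Hb; simpl.
      assert (H1 := Rmax_l s t); assert (H2 := Rmax_r s t).
      exists (RInt f t b); split.
      { apply (RInt_correct f), ex_RInt_ray; lra. }
      apply HP; change (Rabs (RInt f t b - (K - RInt f T t)) < eps).
      generalize (RInt_ray_Chasles t b Ht ltac:(lra)) (HK b ltac:(lra))
        (RInt_ray_mono s b Hs ltac:(lra)) (cond_pos eps).
      intros; apply Rabs_def1; lra.
    + exfalso; assert (K <= K - eps); [| generalize (cond_pos eps); lra].
      apply Hlub; intros v (s & Hs & ->).
      apply Rnot_lt_le; intros H; apply Hno; now exists s.
Qed.

End Primitive.

(** If [F] were bounded, the integral of [h * F^a] would be at most a multiple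
    of that of [h]. This passes the divergence from the outermost integral to
    the inner ones. *)
Lemma weighted_integral_diverges T h F a :
  0 < a -> ray_continuous T h -> (forall t, T <= t -> 0 <= h t) ->
  (exists B, forall t, T <= t -> RInt h T t <= B) ->
  ray_continuous T F -> (forall s t, T <= s -> s <= t -> F s <= F t) ->
  is_lim (fun t => RInt (fun s => h s * opow (F s) a) T t) p_infty p_infty ->
  is_lim F p_infty p_infty.
Proof.
  intros Ha Hh Hh0 [B HB] HF HFmono Hdiv; apply is_lim_spec; intros M.
  destruct (classic (exists s, T <= s /\ M < F s)) as [(s & Hs & HM) | Hno].
  { exists s; intros t Ht; generalize (HFmono s t Hs ltac:(lra)); lra. }
  exfalso.
  apply is_lim_spec in Hdiv.
  set (A := Rabs (opow M a)).
  destruct (Hdiv (A * B)) as [N HN].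
  assert (H1 := Rmax_l T (N + 1)); assert (H2 := Rmax_r T (N + 1)).
  set (t := Rmax T (N + 1)) in *.
  specialize (HN t ltac:(lra)); apply (Rlt_not_le _ _ HN).
  apply Rle_trans with (RInt (fun s => scal A (h s)) T t).
  - apply RInt_le; [easy | | |].
    + apply (ex_RInt_ray T); try lra.
      apply ray_continuous_mult; [easy |]; now apply ray_continuous_opow.
    + apply (ex_RInt_scal h), (ex_RInt_ray T); trivial; lra.
    + intros s Hs; rewrite Rmult_comm.
      apply Rmult_le_compat_r; [apply Hh0; lra |].
      apply Rle_trans with (opow M a); [| apply Rle_abs].
      apply opow_le; [easy |].
      apply Rnot_lt_le; intros H; apply Hno; exists s; lra.
  - rewrite (RInt_scal h) by (apply (ex_RInt_ray T); trivial; lra).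
    apply Rmult_le_compat_l; [apply Rabs_pos | now apply HB].
Qed.

(** * Descent to minus infinity *)

(** The constant of integration is absorbed by half of [c * G], which keeps the
    same form of bound for the next integration. *)
Lemma integrate_upper_bound T v dv G g c :
  0 < c ->
  (forall t, T <= t -> is_derive v t (dv t)) ->
  (forall t, T <= t -> is_derive G t (g t)) ->
  is_lim G p_infty p_infty ->
  (forall t, T <= t -> dv t <= - c * g t) ->
  exists T', T <= T' /\ forall t, T' <= t -> v t <= - (c / 2) * G t.
Proof.
  intros Hc Hv HG Hlim Hle.
  apply is_lim_spec in Hlim.
  destruct (Hlim ((v T + c * G T) / (c / 2))) as [N HN].
  assert (H1 := Rmax_l T (N + 1)); assert (H2 := Rmax_r T (N + 1)).
  exists (Rmax T (N + 1)); split; [easy |]; intros t Ht.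
  specialize (HN t ltac:(lra)).
  apply Rlt_div_l in HN; [| lra].
  assert (H : v t + c * G t <= v T + c * G T); [| lra].
  apply (derivative_nonpos_ge T (fun x => v x + c * G x)
           (fun x => dv x + c * g x)); try lra.
  - intros x Hx.
    apply (is_derive_plus v (fun z => c * G z)); [now apply Hv |].
    apply (is_derive_scal G), HG, Hx.
  - intros x Hx; generalize (Hle x Hx); lra.
Qed.

Lemma nonincreasing_positive_limit T y :
  (forall t, T <= t -> 0 < y t) ->
  (forall s t, T <= s -> s <= t -> y t <= y s) ->
  is_lim y p_infty 0 \/ exists c, 0 < c /\ forall t, T <= t -> c <= y t.
Proof.
  intros Hpos Hmono.
  destruct (classic (exists c, 0 < c /\ forall t, T <= t -> c <= y t))
    as [Hc | Hno]; [now right | left].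
  apply is_lim_spec; intros eps.
  destruct (classic (exists s, T <= s /\ y s < eps)) as [(s & Hs & Hys) | Hall].
  - exists s; intros t Ht; rewrite Rminus_0_r.
    generalize (Hpos t ltac:(lra)) (Hmono s t Hs ltac:(lra)).
    intros; apply Rabs_def1; lra.
  - exfalso; apply Hno; exists eps; split; [apply cond_pos |].
    intros t Ht; apply Rnot_lt_le; intros H; apply Hall; now exists t.
Qed.

(** The heart of the argument. Writing [u = r1 (y')^alpha] and
    [w = r2 (u')^beta], the sign of [w'] makes [w] monotone, hence eventually of
    one sign, and this propagates through [u] to [y], which therefore tends to 0
    or stays above some [c > 0]. In the latter case [p] being bounded makes
    [y (sigma t)] at least a multiple of [p (sigma t)], and integrating the
    equation three times bounds [y] above by a negative multiple of [O], which
    tends to infinity. *)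
Lemma positive_solution_tends_to_0 (T alpha beta gamma M : R)
  (r1 r2 q sigma p J I O y dy du dw : R -> R) :
  0 < alpha -> 0 < beta -> 0 < gamma ->
  (forall t, T <= t -> 0 < r1 t) -> (forall t, T <= t -> 0 < r2 t) ->
  (forall t, T <= t -> 0 <= q t) -> (forall t, T <= t -> t <= sigma t) ->
  (forall t, T <= t -> 0 <= p t <= M) ->
  (forall t, T <= t -> is_derive J t (opow (p (sigma t)) gamma * q t)) ->
  (forall t, T <= t ->
     is_derive I t (opow (r2 t) (- / beta) * opow (J t) (/ beta))) ->
  (forall t, T <= t ->
     is_derive O t (opow (r1 t) (- / alpha) * opow (I t) (/ alpha))) ->
  is_lim J p_infty p_infty -> is_lim I p_infty p_infty ->
  is_lim O p_infty p_infty ->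
  (forall t, T <= t -> is_derive y t (dy t)) ->
  (forall t, T <= t -> is_derive (fun s => r1 s * opow (dy s) alpha) t (du t)) ->
  (forall t, T <= t -> is_derive (fun s => r2 s * opow (du s) beta) t (dw t)) ->
  (forall t, T <= t -> dw t + q t * opow (y (sigma t)) gamma = 0) ->
  (forall t, T <= t -> 0 < y t) ->
  is_lim y p_infty 0.
Proof.
  intros Ha Hb Hg Hr1 Hr2 Hq Hs Hp HJ HI HO LJ LI LO Hy Hu Hw Heq Hpos.
  destruct (classic (is_lim y p_infty 0)) as [H0 | H0]; [easy | exfalso].
  assert (Hdw : forall t, T <= t -> dw t <= 0).
  { intros t Ht.
    assert (Hst := Hs t Ht); assert (Hyp := Hpos (sigma t) ltac:(lra)).
    generalize (Rmult_le_pos _ _ (Hq t Ht) (opow_nonneg _ gamma (Rlt_le _ _ Hyp)))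
      (Heq t Ht); lra. }
  assert (signed : forall T1 r d a, (forall t, T1 <= t -> 0 < r t) ->
    (forall t, T1 <= t -> 0 <= r t * opow (d t) a) \/
    (forall t, T1 <= t -> r t * opow (d t) a <= 0) ->
    (forall t, T1 <= t -> 0 <= d t) \/ (forall t, T1 <= t -> d t <= 0)).
  { intros T1 r d a Hr [H | H]; [left | right]; intros t Ht;
      specialize (H t Ht); specialize (Hr t Ht).
    - apply (opow_ge_0_inv _ a), Rmult_le_reg_l with (r t); lra.
    - apply (opow_le_0_inv _ a), Rmult_le_reg_l with (r t); lra. }
  destruct (monotone_eventually_signed T _ _ Hw (or_intror Hdw))
    as (T1 & HT1 & S1).
  apply (signed T1 r2 du beta) in S1; [| intros; apply Hr2; lra].
  destruct (monotone_eventually_signed T1 _ _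
              (fun t Ht => Hu t (Rle_trans _ _ _ HT1 Ht)) S1) as (T2 & HT2 & S2).
  apply (signed T2 r1 dy alpha) in S2; [| intros; apply Hr1; lra].
  assert (Hy2 : forall t, T2 <= t -> is_derive y t (dy t)) by (intros; apply Hy; lra).
  assert (Hc : exists c, 0 < c /\ forall t, T2 <= t -> c <= y t).
  { destruct S2 as [S2 | S2].
    - exists (y T2); split; [apply Hpos; lra |]; intros t Ht.
      apply (derivative_nonneg_le T2 y dy); trivial; lra.
    - destruct (nonincreasing_positive_limit T2 y) as [H | H]; try easy.
      + intros; apply Hpos; lra.
      + exact (derivative_nonpos_ge T2 y dy Hy2 S2). }
  destruct Hc as (c & Hc & Hyc).
  assert (HM : 0 < M + 1) by (generalize (Hp T (Rle_refl T)); lra).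
  (* [M + 1] rather than [M], to divide by a positive number. *)
  set (k := c / (M + 1)).
  assert (Hk : 0 < k) by (apply Rdiv_lt_0_compat; lra).
  set (k0 := opow k gamma).
  assert (Hk0 : 0 < k0) by now apply opow_pos.
  assert (Hdw' : forall t, T2 <= t ->
            dw t <= - k0 * (opow (p (sigma t)) gamma * q t)).
  { intros t Ht.
    assert (Hst := Hs t ltac:(lra)); assert (Hpt := Hp (sigma t) ltac:(lra)).
    assert (Hlow : k * p (sigma t) <= y (sigma t)).
    { apply Rle_trans with (k * (M + 1)); [apply Rmult_le_compat_l; lra |].
      unfold k; replace (c / (M + 1) * (M + 1)) with c by (field; lra).
      apply Hyc; lra. }
    apply (opow_le _ _ gamma Hg) in Hlow; rewrite opow_mult in Hlow.
    apply (Rmult_le_compat_l _ _ _ (Hq t ltac:(lra))) in Hlow.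
    generalize (Heq t ltac:(lra)); fold k0 in Hlow; lra. }
  destruct (integrate_upper_bound T2 _ dw J _ k0 Hk0
     (fun t Ht => Hw t ltac:(lra)) (fun t Ht => HJ t ltac:(lra)) LJ Hdw')
    as (T3 & HT3 & B3); cbv beta in B3.
  set (k1 := opow (k0 / 2) (/ beta)).
  assert (Hk1 : 0 < k1) by (apply opow_pos; lra).
  assert (Hdu' : forall t, T3 <= t ->
            du t <= - k1 * (opow (r2 t) (- / beta) * opow (J t) (/ beta))).
  { intros t Ht; apply solve_power; [easy | apply Hr2; lra | now apply B3]. }
  destruct (integrate_upper_bound T3 _ du I _ k1 Hk1
     (fun t Ht => Hu t ltac:(lra)) (fun t Ht => HI t ltac:(lra)) LI Hdu')
    as (T4 & HT4 & B4); cbv beta in B4.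
  set (k2 := opow (k1 / 2) (/ alpha)).
  assert (Hk2 : 0 < k2) by (apply opow_pos; lra).
  assert (Hdy' : forall t, T4 <= t ->
            dy t <= - k2 * (opow (r1 t) (- / alpha) * opow (I t) (/ alpha))).
  { intros t Ht; apply solve_power; [easy | apply Hr1; lra | now apply B4]. }
  destruct (integrate_upper_bound T4 _ dy O _ k2 Hk2
     (fun t Ht => Hy t ltac:(lra)) (fun t Ht => HO t ltac:(lra)) LO Hdy')
    as (T5 & HT5 & B5).
  apply is_lim_spec in LO; destruct (LO 0) as [N HN].
  assert (H1 := Rmax_l T5 (N + 1)); assert (H2 := Rmax_r T5 (N + 1)).
  set (t := Rmax T5 (N + 1)) in *.
  assert (Ot := HN t ltac:(lra)).
  generalize (B5 t H1) (Hpos t ltac:(lra))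
    (Rmult_lt_0_compat (k2 / 2) (O t) ltac:(lra) Ot); lra.
Qed.

(** * Property A *)

(** Beyond its last zero a continuous function keeps its sign, by the
    intermediate value theorem. *)
Lemma nonoscillatory_signed Ty y :
  ray_continuous Ty y -> ~ oscillatory Ty y ->
  exists T, Ty < T /\
    ((forall t, T <= t -> 0 < y t) \/ (forall t, T <= t -> 0 < - y t)).
Proof.
  intros Hy Hosc.
  apply not_all_ex_not in Hosc; destruct Hosc as [T0 HT0].
  assert (H1 := Rmax_l T0 Ty); assert (H2 := Rmax_r T0 Ty).
  set (T := Rmax T0 Ty + 1).
  assert (Hne : forall t, T <= t -> y t <> 0).
  { intros t Ht E; apply HT0; exists t; unfold T in Ht; repeat split; lra. }
  exists T; split; [unfold T; lra |].
  assert (same : forall t, T <= t -> 0 < y T * y t).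
  { intros t Ht; apply Rnot_le_lt; intros Hle.
    destruct (IVT_gen (clamp Ty y) T t 0) as (x & Hx & E).
    - intros z; apply continuity_pt_filterlim, Hy.
    - rewrite !clamp_eq by (unfold T in *; lra).
      assert (HyT := Hne T (Rle_refl T)).
      unfold Rmin, Rmax; destruct (Rle_dec (y T) (y t));
        split; apply Rnot_lt_le; intros H;
        first
          [ assert (0 < y T * y t) by (apply Rmult_lt_0_compat; lra); lra
          | assert (0 < - y T * - y t) by (apply Rmult_lt_0_compat; lra); lra ].
    - rewrite Rmin_left in Hx by easy.
      rewrite clamp_eq in E by (unfold T in *; lra).
      apply (Hne x); [lra | easy]. }
  destruct (Rtotal_order (y T) 0) as [Hn | [Hz | Hp]].
  - right; intros t Ht; specialize (same t Ht).
    apply Rmult_lt_reg_l with (- y T); lra.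
  - exfalso; now apply (Hne T (Rle_refl T)).
  - left; intros t Ht; specialize (same t Ht).
    apply Rmult_lt_reg_l with (y T); lra.
Qed.

Theorem theorem2p2
  (t0 alpha beta gamma : R) (r1 r2 q sigma dsigma : R -> R)
  (ht0 : 0 < t0)
  (halpha : odd_quotient alpha)
  (hbeta : odd_quotient beta)
  (hgamma : odd_quotient gamma)
  (hr1_cont : continuous_on_ray t0 r1)
  (hr1_pos : forall t, t0 <= t -> 0 < r1 t)
  (hr2_cont : continuous_on_ray t0 r2)
  (hr2_pos : forall t, t0 <= t -> 0 < r2 t)
  (hr1_int : ex_RInt_gen (fun s => opow (r1 s) (- / alpha))
               (at_point t0) (Rbar_locally p_infty))
  (hr2_int : ex_RInt_gen (fun s => opow (r2 s) (- / beta))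
               (at_point t0) (Rbar_locally p_infty))
  (hq_cont : continuous_on_ray t0 q)
  (hq_nonneg : forall t, t0 <= t -> 0 <= q t)
  (hq_nonvanishing : forall T, t0 <= T -> exists t, T <= t /\ q t <> 0)
  (hsigma_pos : forall t, t0 <= t -> 0 < sigma t)
  (hsigma_diff : derivative_on_ray t0 sigma dsigma)
  (hsigma_C1 : continuous_on_ray t0 dsigma)
  (hsigma_adv : forall t, t0 <= t -> t <= sigma t)
  (hsigma_mono : forall t, t0 <= t -> 0 <= dsigma t)
  (hex : exists (Ty : R) (y : R -> R),
           proper_solution t0 alpha beta gamma r1 r2 q sigma Ty y)
  (hdiv : is_lim
    (fun T => RInt (fun v =>
       opow (r1 v) (- / alpha) *
       opow (RInt (fun u =>
               opow (r2 u) (- / beta) *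
               opow (RInt (fun s =>
                       opow (pi alpha beta r1 r2 (sigma s)) gamma * q s)
                     t0 u) (/ beta))
             t0 v) (/ alpha))
     t0 T)
    p_infty p_infty) :
  property_A t0 alpha beta gamma r1 r2 q sigma.

Proof.
  apply odd_quotient_pos in halpha, hbeta, hgamma.
  assert (halpha' := Rinv_0_lt_compat _ halpha).
  assert (hbeta' := Rinv_0_lt_compat _ hbeta).
  assert (Cr1 := ray_continuous_opow_pos _ _ (- / alpha) hr1_pos
                   (ray_continuous_intro _ _ hr1_cont)).
  assert (Cr2 := ray_continuous_opow_pos _ _ (- / beta) hr2_pos
                   (ray_continuous_intro _ _ hr2_cont)).
  assert (Csigma := ray_continuous_of_derivative _ _ _ hsigma_diff).
  apply ray_continuous_intro in hq_cont.
  set (h1 := fun s => opow (r1 s) (- / alpha)) in *.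
  set (h2 := fun s => opow (r2 s) (- / beta)) in *.
  assert (P1 : forall t, t0 <= t -> 0 <= h1 t).
  { intros t Ht; apply Rlt_le, opow_pos, hr1_pos, Ht. }
  assert (P2 : forall t, t0 <= t -> 0 <= h2 t).
  { intros t Ht; apply Rlt_le, opow_pos, hr2_pos, Ht. }
  assert (Hsig0 : forall t, t0 <= t -> t0 <= sigma t).
  { intros t Ht; generalize (hsigma_adv t Ht); lra. }
  assert (Bd1 := ex_RInt_gen_bounded t0 h1 Cr1 P1 hr1_int).
  assert (Bd2 := ex_RInt_gen_bounded t0 h2 Cr2 P2 hr2_int).
  (* [pi2], and then [pi], is a constant minus a primitive, hence continuous,
     bounded and nonnegative. *)
  assert (Tail : forall h, ray_continuous t0 h -> (forall t, t0 <= t -> 0 <= h t) ->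
    (exists B, forall t, t0 <= t -> RInt h t0 t <= B) ->
    let g := fun t => RInt_gen h (at_point t) (Rbar_locally p_infty) in
    ray_continuous t0 g /\ exists K, forall t, t0 <= t -> 0 <= g t <= K).
  { intros h Ch Ph [B HB] g.
    destruct (RInt_gen_tail t0 h Ch Ph B HB) as (K & HK & Hg).
    split.
    - apply ray_continuous_ext with (fun t => K - RInt h t0 t).
      { intros t Ht; symmetry; now apply Hg. }
      intros t; apply (continuous_minus (fun _ => K) (clamp t0 (fun u => RInt h t0 u))).
      + apply continuous_const.
      + now apply ray_continuous_RInt.
    - exists K; intros t Ht; unfold g; rewrite Hg by easy.
      generalize (HK t Ht) (RInt_ray_nonneg t0 h Ch Ph t Ht); lra. }
  destruct (Tail h2 Cr2 P2 Bd2) as [Cpi2 [K2 HK2]].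
  change (ray_continuous t0 (pi2 beta r2)) in Cpi2.
  change (forall t, t0 <= t -> 0 <= pi2 beta r2 t <= K2) in HK2.
  set (h := fun s => h1 s * opow (pi2 beta r2 s) (/ alpha)).
  assert (Ch : ray_continuous t0 h).
  { apply ray_continuous_mult; [easy | now apply ray_continuous_opow]. }
  assert (Ph : forall t, t0 <= t -> 0 <= h t).
  { intros t Ht; apply Rmult_le_pos; [now apply P1 |].
    now apply opow_nonneg, HK2. }
  assert (Bh : exists B, forall t, t0 <= t -> RInt h t0 t <= B).
  { destruct Bd1 as [B HB]; exists (opow K2 (/ alpha) * B); intros t Ht.
    assert (HK2' : 0 <= K2) by (generalize (HK2 t0 (Rle_refl _)); lra).
    apply Rle_trans with (RInt (fun s => scal (opow K2 (/ alpha)) (h1 s)) t0 t).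
    - apply RInt_le; [easy | apply (ex_RInt_ray t0); trivial; lra | |].
      + apply (ex_RInt_scal h1), (ex_RInt_ray t0); trivial; lra.
      + intros s Hs; unfold h; rewrite Rmult_comm.
        apply Rmult_le_compat_r; [apply P1; lra |].
        apply opow_le; [easy | apply HK2; lra].
    - rewrite (RInt_scal h1) by (apply (ex_RInt_ray t0); trivial; lra).
      apply Rmult_le_compat_l; [now apply opow_nonneg | now apply HB]. }
  destruct (Tail h Ch Ph Bh) as [Cpi [M HM]].
  set (p := pi alpha beta r1 r2) in *.
  change (ray_continuous t0 p) in Cpi.
  change (forall t, t0 <= t -> 0 <= p t <= M) in HM.
  set (j := fun s => opow (p (sigma s)) gamma * q s) in *.
  assert (Cj : ray_continuous t0 j).
  { apply ray_continuous_mult; [| easy].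
    apply ray_continuous_opow; [easy | now apply ray_continuous_comp]. }
  assert (Pj : forall t, t0 <= t -> 0 <= j t).
  { intros t Ht; apply Rmult_le_pos; [| now apply hq_nonneg].
    now apply opow_nonneg, HM, Hsig0. }
  set (J := fun u => RInt j t0 u) in *.
  assert (CJ : ray_continuous t0 J) by now apply ray_continuous_RInt.
  set (i := fun u => h2 u * opow (J u) (/ beta)) in *.
  assert (Ci : ray_continuous t0 i).
  { apply ray_continuous_mult; [easy | now apply ray_continuous_opow]. }
  assert (Pi : forall t, t0 <= t -> 0 <= i t).
  { intros t Ht; apply Rmult_le_pos; [now apply P2 |].
    now apply opow_nonneg, RInt_ray_nonneg. }
  set (I := fun v => RInt i t0 v) in *.
  assert (CI : ray_continuous t0 I) by now apply ray_continuous_RInt.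
  set (o := fun v => h1 v * opow (I v) (/ alpha)) in *.
  assert (Co : ray_continuous t0 o).
  { apply ray_continuous_mult; [easy | now apply ray_continuous_opow]. }
  set (O := fun v => RInt o t0 v) in *.
  change (is_lim O p_infty p_infty) in hdiv.
  assert (LI : is_lim I p_infty p_infty).
  { apply (weighted_integral_diverges t0 h1 I (/ alpha)); trivial.
    now apply RInt_ray_mono. }
  assert (LJ : is_lim J p_infty p_infty).
  { apply (weighted_integral_diverges t0 h2 J (/ beta)); trivial.
    now apply RInt_ray_mono. }
  intros Ty y [[HTy [_ (dy & du & dw & _ & Dy & _ & Du & _ & Dw & Heq)]] _].
  destruct (classic (oscillatory Ty y)) as [Hosc | Hosc]; [now left | right].
  destruct (nonoscillatory_signed Ty y
              (ray_continuous_of_derivative _ _ _ Dy) Hosc) as (T & HT & HS).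
  assert (DT : forall f df, derivative_on_ray Ty f df ->
                 forall t, T <= t -> is_derive f t (df t)).
  { intros f df Hf t Ht; apply (derivative_on_ray_interior Ty); [easy | lra]. }
  assert (DR : forall f, ray_continuous t0 f ->
    forall t, T <= t -> is_derive (fun u => RInt f t0 u) t (f t)).
  { intros f Cf t Ht; apply is_derive_RInt_ray; [easy | lra]. }
  assert (Main := positive_solution_tends_to_0 T alpha beta gamma M
    r1 r2 q sigma p J I O).
  destruct HS as [HS | HS].
  - apply (Main y dy du dw); trivial; intros t Ht.
    all: try (first [apply hr1_pos | apply hr2_pos | apply hq_nonneg
                    | apply hsigma_adv | apply HM | apply Heq]; lra).
    + exact (DR j Cj t Ht).
    + exact (DR i Ci t Ht).
    + exact (DR o Co t Ht).
    + now apply DT.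
    + exact (DT _ _ Du t Ht).
    + exact (DT _ _ Dw t Ht).
  (* [opow] being odd, [- y] solves the equation as well. *)
  - apply is_lim_ext with (fun t => - - y t); [intros; apply Ropp_involutive |].
    replace (Finite 0) with (Rbar_opp 0) by (simpl; now rewrite Ropp_0).
    apply is_lim_opp.
    apply (Main (fun t => - y t) (fun t => - dy t) (fun t => - du t)
             (fun t => - dw t)); trivial; intros t Ht.
    all: try (first [apply hr1_pos | apply hr2_pos | apply hq_nonneg
                    | apply hsigma_adv | apply HM]; lra).
    + exact (DR j Cj t Ht).
    + exact (DR i Ci t Ht).
    + exact (DR o Co t Ht).
    + apply (is_derive_opp y); now apply DT.
    + apply is_derive_ext with (fun s => - (r1 s * opow (dy s) alpha)).
      { intros s; rewrite opow_opp; apply Ropp_mult_distr_r. }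
      apply (is_derive_opp (fun s => r1 s * opow (dy s) alpha)).
      exact (DT _ _ Du t Ht).
    + apply is_derive_ext with (fun s => - (r2 s * opow (du s) beta)).
      { intros s; rewrite opow_opp; apply Ropp_mult_distr_r. }
      apply (is_derive_opp (fun s => r2 s * opow (du s) beta)).
      exact (DT _ _ Dw t Ht).
    + rewrite opow_opp; generalize (Heq t ltac:(lra)); lra.
Qed.
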